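(* Let $\Phi:[0,T]\times C\to\mathbb{R}$ be non-anticipative and twice continuously Fréchet differentiable. Let $t\in[0,T)$. Then for every $\phi(\cdot)\in C$, the Fréchet derivatives $D_x\Phi(t,\phi(\cdot))$ and $D^2_{xx}\Phi(t,\phi(\cdot))$ have unique weakly continuous linear and bilinear extensions $$\overline{D_x\Phi(t,\phi(\cdot))}\in(C\oplus B_t)^*,\qquad \overline{D^2_{xx}\Phi(t,\phi(\cdot))}\in(C\oplus B_t)^\dagger,$$ respectively.
   Context: Fix $T>0$, $n\ge1$. $C$ is the Banach space of continuous functions $[0,T]\to\mathbb{R}^n$ with the sup norm $\|\cdot\|$. For a normed space $E$, $E^*$ is the space of bounded linear functionals $E\to\mathbb{R}$ and $E^\dagger$ the space of bounded bilinear functionals $E\times E\to\mathbb{R}$, with operator norms. A functional $\Psi:[0,T]\times C\to\mathbb{R}$ is non-anticipative if $\Psi(t,x(\cdot))=\Psi(t,y(\cdot))$ whenever $t\in[0,T]$ and $x,y\in C$ satisfy $x=y$ on $[0,t]$. For non-anticipative $\Psi$, $\Psi(t,\cdot)$ is Fréchet differentiable at $\gamma(\cdot)\in C$ with derivative $D_x\Psi(t,\gamma(\cdot))\in C^*$ if for $\varphi(\cdot)\in C$, $\Psi(t,\varphi(\cdot))=\Psi(t,\gamma(\cdot))+D_x\Psi(t,\gamma(\cdot))(\varphi(\cdot)-\gamma(\cdot))+o(\|(\varphi(\cdot)-\gamma(\cdot))1_{[0,t]}\|)$; the second derivative $D^2_{xx}\Psi(t,\gamma(\cdot))\in C^\dagger$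 is defined similarly. For $t\in[0,T)$, $1_{\{t\}}:[0,T]\to\mathbb{R}$ is the indicator function of $\{t\}$, $B_t=\{v1_{\{t\}}:v\in\mathbb{R}^n\}$, and $C\oplus B_t=\{\phi(\cdot)+v1_{\{t\}}:\phi(\cdot)\in C,\ v\in\mathbb{R}^n\}$ with norm $\|\phi(\cdot)+v1_{\{t\}}\|=\sup_{s\in[0,T]}|\phi(s)|+|v|$. A linear extension $\overline{L}\in(C\oplus B_t)^*$ of $L\in C^*$ is weakly continuous if, whenever $(\xi^k)$ is a bounded sequence in $C$ with $\xi^k(s)\to\xi(s)$ for all $s\in[0,T]$, where $\xi\in C\oplus B_t$, then $L(\xi^k)\to\overline{L}(\xi)$. Similarly, a bilinear extension $\overline{Q}\in(C\oplus B_t)^\dagger$ of $Q\in C^\dagger$ is weakly continuous if, whenever $(\xi^k),(\eta^k)$ are bounded sequences in $C$ converging pointwise on $[0,T]$ to $\xi,\eta\in C\oplus B_t$ respectively, then $Q(\xi^k,\eta^k)\to\overline{Q}(\xi,\eta)$. *)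

(* Defs.v *)
From HB Require Import structures.
From mathcomp Require Import all_boot all_order all_algebra.
From mathcomp Require Import ring lra.
From mathcomp Require Import all_classical all_reals all_analysis.
Set Implicit Arguments.
Unset Strict Implicit.
Unset Printing Implicit Defensive.
Import Order.TTheory GRing.Theory Num.Theory.
Import numFieldNormedType.Exports.
Local Open Scope classical_set_scope.
Local Open Scope ring_scope.

Section euclidean_norm.
Context {R : realType} {n : nat}.
Implicit Types u v : 'rV[R]_n.

(* The library norm of ['rV[R]_n] is the max norm; [enorm] is the Euclidean
   one.  They induce the same topology. *)
Definition enorm v : R := Num.sqrt (\sum_i v 0 i ^+ 2).

Lemma enorm_ge0 v : 0 <= enorm v. Proof. exact: sqrtr_ge0. Qed.

Lemma sum_sqr_ge0 v : 0 <= \sum_i v 0 i ^+ 2.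
Proof. by apply: sumr_ge0 => i _; exact: sqr_ge0. Qed.

Lemma sum_sqr_eq0 v : \sum_i v 0 i ^+ 2 = 0 -> v = 0.
Proof.
move=> /psumr_eq0P v0; apply/rowP => i; rewrite mxE; apply/eqP.
by rewrite -sqrf_eq0 v0// => j _; exact: sqr_ge0.
Qed.

Lemma enorm0_eq0 v : enorm v = 0 -> v = 0.
Proof.
move=> /eqP; rewrite sqrtr_eq0 => v0; apply: sum_sqr_eq0; apply/eqP.
by rewrite eq_le v0 sum_sqr_ge0.
Qed.

Lemma enormZ (a : R) v : enorm (a *: v) = `|a| * enorm v.
Proof.
rewrite /enorm -sqrtr_sqr -sqrtrM ?sqr_ge0// mulr_sumr.
by congr Num.sqrt; apply: eq_bigr => i _; rewrite mxE exprMn.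
Qed.

Lemma sqr_enorm v : enorm v ^+ 2 = \sum_i v 0 i ^+ 2.
Proof. by rewrite sqr_sqrtr// sum_sqr_ge0. Qed.

Lemma enorm_cauchy_schwarz u v : \sum_i u 0 i * v 0 i <= enorm u * enorm v.
Proof.
have [v0|v0] := eqVneq v 0.
  rewrite [leLHS]big1; last by move=> i _; rewrite v0 mxE mulr0.
  by rewrite mulr_ge0 ?enorm_ge0.
have B0 : 0 < \sum_i v 0 i ^+ 2.
  by rewrite lt_neqAle sum_sqr_ge0 andbT eq_sym; apply: contra_neq v0 => /sum_sqr_eq0.
rewrite /enorm -sqrtrM ?sum_sqr_ge0//; apply: le_trans (ler_norm _) _.
rewrite -sqrtr_sqr ler_sqrt; last by rewrite mulr_ge0 ?sum_sqr_ge0.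
set A := \sum_i u 0 i ^+ 2; set B := \sum_i v 0 i ^+ 2 in B0 *.
set C := \sum_i u 0 i * v 0 i.
rewrite -subr_ge0 -(pmulr_rge0 _ B0).
have -> : B * (A * B - C ^+ 2) = \sum_i (B * u 0 i - C * v 0 i) ^+ 2.
  transitivity (\sum_i (B ^+ 2 * u 0 i ^+ 2 - (B * C * 2) * (u 0 i * v 0 i) +
                        C ^+ 2 * v 0 i ^+ 2)); last first.
    by apply: eq_bigr => i _; rewrite sqrrB !exprMn; congr (_ - _ + _);
       rewrite -mulr_natr; ring.
  by rewrite big_split/= sumrB -!mulr_sumr -/A -/B -/C; ring.
by apply: sumr_ge0 => i _; exact: sqr_ge0.
Qed.

Lemma ler_enormD u v : enorm (u + v) <= enorm u + enorm v.
Proof.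
rewrite -(@ler_pXn2r _ 2)// ?nnegrE ?addr_ge0 ?enorm_ge0//.
rewrite sqrrD !sqr_enorm.
have -> : \sum_i (u + v) 0 i ^+ 2 =
    \sum_i u 0 i ^+ 2 + (\sum_i u 0 i * v 0 i) *+ 2 + \sum_i v 0 i ^+ 2.
  rewrite -sumrMnl -!big_split/=; apply: eq_bigr => i _.
  by rewrite mxE sqrrD.
by rewrite lerD2r lerD2l lerMn2r enorm_cauchy_schwarz.
Qed.

Lemma enorm_le_mx v (M : R) : (forall i, `|v 0 i| <= M) -> 0 <= M ->
  enorm v <= Num.sqrt (n%:R * M ^+ 2).
Proof.
move=> vM M0; rewrite ler_sqrt ?mulr_ge0 ?sqr_ge0//.
rewrite mulr_natl -[n in leRHS]card_ord -sumr_const; apply: ler_sum => i _.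
by rewrite -real_normK ?num_real// lerXn2r ?nnegrE.
Qed.

End euclidean_norm.

Notation time T := (set_type `[0, T]%classic).

Section path_space.
Context {R : realType}.

Context (T : R) (n : nat).

Definition supnorm (f : time T -> 'rV[R]_n) : R := sup (range (enorm \o f)).

Definition continuous_pred : {pred time T -> 'rV[R]_n} :=
  mem [set f : time T -> 'rV[R]_n | continuous f].

Fact continuous_submod_closed : submod_closed continuous_pred.
Proof.
split=> [|a f g]; rewrite !inE/=.
  by move=> s; apply: (@cst_continuous _ _ (0 : 'rV[R]_n)).
move=> cf cg s; have := @cvgD _ _ _ (nbhs s) _ _ _ _ _ (cvgZl_tmp (k := a) (cf s)) (cg s); exact.
Qed.
HB.instance Definition _ := GRing.isSubmodClosed.Build R (time T -> 'rV[R]_n)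
  continuous_pred continuous_submod_closed.

Record cpath := CPath {
  cpath_fun :> time T -> 'rV[R]_n;
  _ : cpath_fun \in continuous_pred }.
HB.instance Definition _ := [isSub for cpath_fun].
HB.instance Definition _ := [Choice of cpath by <:].
HB.instance Definition _ := [SubChoice_isSubLmodule of cpath by <:].

Lemma cpath_continuous (x : cpath) : continuous x.
Proof. by case: x => f /=; rewrite inE. Qed.

Lemma cpath_ext (x y : cpath) : (forall s, x s = y s) -> x = y.
Proof. by move=> xy; apply/val_inj/funext. Qed.

Lemma cpathDE (x y : cpath) s : (x + y : cpath) s = x s + y s. Proof. by []. Qed.
Lemma cpathZE a (x : cpath) s : (a *: x : cpath) s = a *: x s. Proof. by []. Qed.

Lemma cpath_enorm_bounded (x : cpath) : exists M, forall s, enorm (x s) <= M.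
Proof.
have /subspace_valL_continuousP cx := @cpath_continuous x.
have /compact_bounded[M [_ xM]] := continuous_compact cx (@segment_compact R 0 T).
exists (Num.sqrt (n%:R * (`|M| + 1) ^+ 2)) => s.
apply: enorm_le_mx => [i|]; last by rewrite addr_ge0.
have M1 : M < `|M| + 1 by rewrite (le_lt_trans (ler_norm M))// ltrDl.
have xsM : `|x s| <= `|M| + 1.
  apply: (xM _ M1); exists (set_val s); first exact: set_valP.
  by rewrite -[in RHS](@valLK _ _ point _ x).
apply: le_trans xsM; rewrite [leRHS]mx_normrE.
by apply/bigmax_geP; right; exists (0, i).
Qed.

Lemma enorm_le_supnorm (x : cpath) s : enorm (x s) <= supnorm x.
Proof.
have [M xM] := cpath_enorm_bounded x; apply: ub_le_sup; last by exists s.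
by exists M => _ [u _ <-]; exact: xM.
Qed.

Lemma supnorm_le (f : time T -> 'rV[R]_n) (M : R) :
  0 <= M -> (forall s, enorm (f s) <= M) -> supnorm f <= M.
Proof.
move=> M0 fM; rewrite /supnorm.
have [[y Ey]|/nonemptyPn ->] := pselect (range (enorm \o f) !=set0).
  by apply: ge_sup; [exists y|move=> _ [u _ <-]; exact: fM].
by rewrite sup0.
Qed.

Lemma supnorm_ge0 (f : time T -> 'rV[R]_n) : 0 <= supnorm f.
Proof.
rewrite /supnorm; have [[[y Ey] ubE]|/sup_out ->//] :=
  pselect (has_sup (range (enorm \o f))).
by apply: le_trans (ub_le_sup ubE Ey); case: Ey => s _ <-; exact: enorm_ge0.
Qed.

Fact supnormD (x y : cpath) : supnorm (x + y : cpath) <= supnorm x + supnorm y.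
Proof.
apply: supnorm_le => [|s]; first by rewrite addr_ge0 ?supnorm_ge0.
by rewrite cpathDE (le_trans (ler_enormD _ _))// lerD// enorm_le_supnorm.
Qed.

Fact supnormZ_le a (x : cpath) : supnorm (a *: x : cpath) <= `|a| * supnorm x.
Proof.
apply: supnorm_le => [|s]; first by rewrite mulr_ge0 ?supnorm_ge0.
by rewrite cpathZE enormZ ler_wpM2l// enorm_le_supnorm.
Qed.

Fact supnormZ a (x : cpath) : supnorm (a *: x : cpath) = `|a| * supnorm x.
Proof.
apply/eqP; rewrite eq_le supnormZ_le andTb.
have [->|a0] := eqVneq a 0; first by rewrite normr0 mul0r supnorm_ge0.
have := supnormZ_le a^-1 (a *: x).
by rewrite scalerA mulVf// scale1r normfV ler_pdivlMl ?normr_gt0.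
Qed.

Fact supnorm_eq0 (x : cpath) : supnorm x = 0 -> x = 0.
Proof.
move=> x0; apply: cpath_ext => s; apply: enorm0_eq0; apply/eqP.
by rewrite eq_le enorm_ge0 -x0 enorm_le_supnorm.
Qed.

HB.instance Definition _ := Lmodule_isNormed.Build R cpath
  supnormD supnormZ supnorm_eq0.

Lemma cpath_normE (x : cpath) : `|x| = supnorm x. Proof. by []. Qed.

End path_space.
Arguments cpath {R} T n.

Section dual.
Context {R : realType} (E : normedModType R).

Record dual := Dual {
  dual_fun :> E -> R;
  dual_linear : scalar dual_fun;
  dual_bounded : exists M, forall x, `|dual_fun x| <= M * `|x| }.

Record bidual := Bidual {
  bidual_fun :> E -> E -> R;
  bidual_linearl : forall y, scalar (bidual_fun ^~ y);
  bidual_linearr : forall x, scalar (bidual_fun x);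
  bidual_bounded : exists M, forall x y, `|bidual_fun x y| <= M * `|x| * `|y| }.

Lemma dual_ext (f g : dual) : (forall x, f x = g x) -> f = g.
Proof.
case: f g => [f lf bf] [g lg bg] /= /funext fg; case: _ / fg lg bg => lg bg.
by congr Dual; exact: Prop_irrelevance.
Qed.

Lemma bidual_ext (f g : bidual) : (forall x y, f x y = g x y) -> f = g.
Proof.
case: f g => [f llf lrf bf] [g llg lrg bg] /= fg.
have {}fg : f = g by apply/funext => x; apply/funext.
case: _ / fg llg lrg bg => llg lrg bg.
by congr Bidual; exact: Prop_irrelevance.
Qed.

Lemma scalarP (f : E -> R) : scalar f ->
  (forall x y, f (x + y) = f x + f y) * (forall a x, f (a *: x) = a * f x).
Proof.
move=> lf; have f0 : f 0 = 0.
  by have := lf (-1) 0 0; rewrite scaler0 addr0 mulN1r addNr.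
split=> [x y|a x]; first by have := lf 1 x y; rewrite scale1r mul1r.
by have := lf a x 0; rewrite f0 !addr0.
Qed.

Fact dual0_linear : scalar (fun _ : E => 0 : R).
Proof. by move=> a x y; rewrite mulr0 addr0. Qed.
Fact dual0_bounded : exists M : R, forall x : E, `|0 : R| <= M * `|x|.
Proof. by exists 0 => x; rewrite normr0 mul0r. Qed.
Definition dual0 := Dual dual0_linear dual0_bounded.

Fact bidual0_bounded : exists M : R, forall x y : E, `|0 : R| <= M * `|x| * `|y|.
Proof. by exists 0 => x y; rewrite normr0 !mul0r. Qed.
Definition bidual0 := @Bidual (fun _ _ => 0)
  (fun=> dual0_linear) (fun=> dual0_linear) bidual0_bounded.

HB.instance Definition _ := gen_eqMixin dual.
HB.instance Definition _ := gen_choiceMixin dual.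
HB.instance Definition _ := gen_eqMixin bidual.
HB.instance Definition _ := gen_choiceMixin bidual.

Definition opnorm (f : E -> R) : R :=
  sup [set `|f x| | x in [set x : E | `|x| <= 1]].

Lemma opnorm_ub (f : E -> R) (M : R) h : scalar f ->
  (forall x, `|f x| <= M * `|x|) -> `|f h| <= opnorm f * `|h|.
Proof.
move=> lf fM.
have fZ := (scalarP lf).2; have [->|h0] := eqVneq h 0.
  by rewrite -(scale0r 0) fZ mul0r !normr0 scale0r normr0 mulr0.
rewrite -ler_pdivrMr ?normr_gt0// mulrC.
have -> : `|h|^-1 * `|f h| = `|f (`|h|^-1 *: h)|.
  by rewrite fZ normrM normfV normr_id.
apply: ub_le_sup.
  exists `|M| => _ [x /= x1 <-]; apply: le_trans (fM x) _.
  rewrite -[leRHS]mulr1 (le_trans (ler_wpM2r _ (ler_norm M)))//.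
  by rewrite ler_wpM2l.
exists (`|h|^-1 *: h) => //=.
by rewrite normrZ normfV normr_id mulVf// normr_eq0.
Qed.

Lemma opnorm_diff_ub (L L0 : dual) (q : bidual) z h :
  `|L h - L0 h - q z h| <= opnorm (fun x => L x - L0 x - q z x) * `|h|.
Proof.
have [M LM] := dual_bounded L; have [M0 LM0] := dual_bounded L0.
have [N qN] := bidual_bounded q.
apply: (@opnorm_ub (fun x => L x - L0 x - q z x) (M + M0 + N * `|z|)).
  move=> a x y.
  have := dual_linear L a x y; have := dual_linear L0 a x y.
  have := bidual_linearr q z a x y; move=> -> -> ->.
  by rewrite !mulrBr !opprD; ring.
move=> x; rewrite !mulrDl; apply: le_trans (ler_normB _ _) _.
by rewrite lerD//; apply: le_trans (ler_normB _ _) _; rewrite lerD.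
Qed.

Definition biopnorm (f : E -> E -> R) : R :=
  sup [set `|f p.1 p.2| | p in [set p : E * E | `|p.1| <= 1 /\ `|p.2| <= 1]].

End dual.

Section frechet.
Context {R : realType} (T : R) (n : nat).
Local Notation C := (cpath T n).
Implicit Types (Psi : time T -> C -> R) (t : time T) (x y gamma phi : C).

Definition nonanticipative Psi := forall t x y,
  (forall s : time T, val s <= val t -> x s = y s) -> Psi t x = Psi t y.

(* the norm of the (possibly discontinuous) function [x 1_[0,t]] *)
Definition stopped_norm t x : R :=
  supnorm (fun s => \1_[set s : time T | val s <= val t] s *: x s).

Definition is_Dx Psi t gamma (L : dual C) : Prop :=
  (fun phi => Psi t phi - Psi t gamma - L (phi - gamma) : R^o)
    =o_ (nbhs gamma) (fun phi => stopped_norm t (phi - gamma) : R^o).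

Lemma stopped_norm_le t x : stopped_norm t x <= `|x|.
Proof.
apply: supnorm_le => // s; rewrite indicE enormZ.
apply: le_trans (enorm_le_supnorm x s).
by case: (_ \in _); rewrite ?normr1 ?mul1r// normr0 mul0r enorm_ge0.
Qed.

Lemma stopped_norm_ge0 t x : 0 <= stopped_norm t x.
Proof. exact: supnorm_ge0. Qed.

Let near_dir gamma (P : C -> Prop) h : (\forall phi \near gamma, P phi) ->
  exists2 a : R, 0 < a & P (gamma + a *: h).
Proof.
move=> /nbhs_normP[e /= e0 eP]; pose k := `|h| + 1.
have k0 : 0 < k by rewrite ltr_wpDl.
exists (e / (2 * k)); first by rewrite divr_gt0// mulr_gt0.
apply: eP => /=.
rewrite opprD addNKr normrN normrZ gtr0_norm ?divr_gt0 ?mulr_gt0//.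
rewrite mulrAC ltr_pdivrMr ?mulr_gt0// ltr_pM2l//.
by rewrite /k; have := normr_ge0 h; lra.
Qed.

Let little_dir (c k : R) : 0 <= k ->
  (forall e, 0 < e -> exists2 a, 0 < a & `|a * c| <= e * (a * k)) -> c = 0.
Proof.
move=> k0 H; apply/eqP; rewrite -normr_le0; apply/ler_addgt0Pr => e e0.
have k1 : 0 < k + 1 by rewrite ltr_wpDl.
have [b b0] := H (e / (k + 1)) (divr_gt0 e0 k1).
rewrite normrM gtr0_norm// mulrCA ler_pM2l// add0r => /le_trans; apply.
by rewrite mulrAC ler_pdivrMr// ler_pM2l// lerDl.
Qed.

Let subCM (a p q c : R) : a * (p - q) = (c - a * q) - (c - a * p).
Proof. by ring. Qed.

Lemma is_Dx_unique Psi t gamma (L L' : dual C) :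
  is_Dx Psi t gamma L -> is_Dx Psi t gamma L' -> L = L'.
Proof.
move=> /eqoP DL /eqoP DL'; apply: dual_ext => h; apply/eqP.
rewrite -subr_eq0; apply/eqP; apply: (@little_dir _ (2 * `|h|)) => [|e e0].
  by rewrite mulr_ge0.
have [a a0 /= []] := near_dir h (filterI (DL _ e0) (DL' _ e0)).
have -> : gamma + a *: h - gamma = a *: h by rewrite addrC addKr.
rewrite !(scalarP (dual_linear _)).2.
rewrite (ger0_norm (stopped_norm_ge0 _ _)) => rL rL'; exists a => //.
rewrite (subCM _ _ _ (Psi t (gamma + a *: h) - Psi t gamma)).
apply: le_trans (ler_normB _ _) _; apply: le_trans (lerD rL' rL) _.
have := stopped_norm_le t (a *: h); rewrite normrZ gtr0_norm// => sh.
have -> : e * (a * (2 * `|h|)) = e * (a * `|h|) + e * (a * `|h|) by ring.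
by rewrite lerD// ler_wpM2l// ltW.
Qed.

Definition Dx Psi t gamma : dual C := xget (dual0 C) (is_Dx Psi t gamma).

(* [Q] is the Fréchet derivative at [gamma] of [Dx Psi t : C -> dual C]; the
   first argument of [Q] is the new direction of differentiation. *)
Definition is_Dxx Psi t gamma (Q : bidual C) : Prop :=
  (fun phi => opnorm (fun h =>
      Dx Psi t phi h - Dx Psi t gamma h - Q (phi - gamma) h) : R^o)
    =o_ (nbhs gamma) (fun phi => stopped_norm t (phi - gamma) : R^o).

Lemma is_Dxx_unique Psi t gamma (Q Q' : bidual C) :
  is_Dxx Psi t gamma Q -> is_Dxx Psi t gamma Q' -> Q = Q'.
Proof.
move=> /eqoP DQ /eqoP DQ'; apply: bidual_ext => h k; apply/eqP.
rewrite -subr_eq0; apply/eqP.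
apply: (@little_dir _ (2 * `|h| * `|k|)) => [|e e0]; first by rewrite !mulr_ge0.
have [a a0 /= []] := near_dir h (filterI (DQ _ e0) (DQ' _ e0)).
have -> : gamma + a *: h - gamma = a *: h by rewrite addrC addKr.
rewrite (ger0_norm (stopped_norm_ge0 _ _)) => rQ rQ'; exists a => //.
set D := Dx Psi t (gamma + a *: h) in rQ rQ' *.
set D0 := Dx Psi t gamma in rQ rQ' *.
have ub (q : bidual C) : `|opnorm (fun x => D x - D0 x - q (a *: h) x) : R^o|
    <= e * stopped_norm t (a *: h) ->
    `|D k - D0 k - a * q h k| <= e * (a * `|h|) * `|k|.
  move=> /(le_trans (ler_norm _)) rq.
  have -> : a * q h k = q (a *: h) k by rewrite (scalarP (bidual_linearl q k)).2.
  apply: le_trans (opnorm_diff_ub D D0 q (a *: h) k) _.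
  apply: ler_wpM2r => //; apply: le_trans rq _; rewrite ler_pM2l//.
  by apply: le_trans (stopped_norm_le _ _) _; rewrite normrZ gtr0_norm.
rewrite (subCM _ _ _ (D k - D0 k)).
apply: le_trans (ler_normB _ _) _.
apply: le_trans (lerD (ub _ rQ') (ub _ rQ)) _.
by rewrite le_eqVlt; apply/orP; left; apply/eqP; ring.
Qed.

Definition Dxx Psi t gamma : bidual C := xget (bidual0 C) (is_Dxx Psi t gamma).

(* Each [Psi t : C -> R] is of class C^2, for the operator norms on the spaces
   of derivatives; no regularity in [t] is required. *)
Definition twice_continuously_frechet Psi : Prop := forall t,
  [/\ forall gamma, exists L, is_Dx Psi t gamma L,
      forall gamma, opnorm (Dx Psi t phi \- Dx Psi t gamma)
                      @[phi --> gamma] --> (0 : R),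
      forall gamma, exists Q, is_Dxx Psi t gamma Q &
      forall gamma,
        biopnorm (fun x y => Dxx Psi t phi x y - Dxx Psi t gamma x y)
                      @[phi --> gamma] --> (0 : R)].

End frechet.

Section jump.
Context {R : realType} (T : R) (n : nat).

(* [C (+) B_t]: the pair [(phi, v)] stands for the function
   [phi + v 1_{t}], see [jpath_fun]. *)
Definition jpath (t : time T) := (cpath T n * 'rV[R]_n)%type.

Context (t : time T).
HB.instance Definition _ := GRing.Lmodule.copy (jpath t) (cpath T n * 'rV[R]_n)%type.

Definition jpath_fun (xi : jpath t) : time T -> 'rV[R]_n :=
  fun s => xi.1 s + \1_[set t] s *: xi.2.

Definition jpath_norm (xi : jpath t) : R := supnorm xi.1 + enorm xi.2.

Fact jpath_normD (x y : jpath t) : jpath_norm (x + y) <= jpath_norm x + jpath_norm y.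
Proof. by rewrite addrACA lerD ?supnormD ?ler_enormD. Qed.

Fact jpath_normZ a (x : jpath t) : jpath_norm (a *: x) = `|a| * jpath_norm x.
Proof. by rewrite mulrDr -supnormZ -enormZ. Qed.

Fact jpath_norm_eq0 (x : jpath t) : jpath_norm x = 0 -> x = 0.
Proof.
move=> /eqP; rewrite paddr_eq0 ?supnorm_ge0 ?enorm_ge0// => /andP[/eqP x1 /eqP x2].
by case: x x1 x2 => x v /= /supnorm_eq0 -> /enorm0_eq0 ->.
Qed.

HB.instance Definition _ := Lmodule_isNormed.Build R (jpath t)
  jpath_normD jpath_normZ jpath_norm_eq0.

Lemma jpath_normE (xi : jpath t) : `|xi| = `|xi.1| + enorm xi.2.
Proof. by []. Qed.

(* For t < T the point t is not isolated in [0, T], so the representation of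
   an element of [C (+) B_t] by a pair is unique. *)
Lemma jpath_fun_inj : val t < T -> injective jpath_fun.
Proof.
move=> tT x y xy.
have xyE s : s != t -> x.1 s = y.1 s.
  move=> st; have := congr1 (@^~ s) xy; rewrite /jpath_fun indicE.
  have -> : (s \in [set t]) = false by apply: memNset => /= ste; rewrite ste eqxx in st.
  by rewrite !scale0r !addr0.
have xyt : x.1 t = y.1 t.
  apply/eqP; apply/negPn/negP => /eqP xyt.
  pose h := x.1 - y.1; have ht : h t != 0 by rewrite subr_eq0; exact/eqP.
  have : \forall s \near t, h s != 0.
    have := @cvgr_neq0 _ _ _ _ _ _ _ (@cpath_continuous _ _ _ h t) ht.
    exact.
  move=> /nbhs_ballP[e /= e0].
  have /andP[t0 _] : 0 <= val t <= T by have := valP t; rewrite inE/= in_itv.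
  pose d := Num.min (e / 2) (T - val t).
  have d0 : 0 < d by rewrite lt_min subr_gt0 tT divr_gt0.
  have de : d < e by rewrite gt_min; apply/orP; left; lra.
  have dT : d <= T - val t by rewrite ge_min lexx orbT.
  have sT : val t + d \in `[0, T]%classic.
    by rewrite inE/= in_itv/= addr_ge0 ?(ltW d0)//= addrC -lerBrDr.
  pose s : time T := exist _ (val t + d) sT.
  move=> /(_ s) H; have {H} /negP[] : h s != 0.
    apply: H; change (`|val t - (val t + d)| < e).
    by rewrite opprD addNKr normrN gtr0_norm.
  apply/eqP; change (x.1 s - y.1 s = 0).
  rewrite xyE ?subrr//; apply/eqP => /(congr1 val) /= /eqP.
  by rewrite -[eqbRHS]addr0 (inj_eq (addrI _)) gt_eqF.
have x1 : x.1 = y.1.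
  by apply: cpath_ext => s; have [->//|] := eqVneq s t; exact: xyE.
have := congr1 (@^~ t) xy; rewrite /jpath_fun x1 indicE mem_set// !scale1r.
by move=> /addrI; case: x y x1 {xy xyE xyt} => ? ? [? ?] /= -> ->.
Qed.

Definition cpath_jpath (x : cpath T n) : jpath t := (x, 0).

Definition weakly_continuous_extension (L : dual (cpath T n))
    (Lbar : dual (jpath t)) : Prop :=
  (forall x, Lbar (cpath_jpath x) = L x) /\
  forall (xi_ : nat -> cpath T n) (xi : jpath t),
    (exists M, forall k, `|xi_ k| <= M) ->
    (forall s, xi_ k s @[k --> \oo] --> jpath_fun xi s) ->
    L (xi_ k) @[k --> \oo] --> Lbar xi.

Definition weakly_continuous_biextension (Q : bidual (cpath T n))
    (Qbar : bidual (jpath t)) : Prop :=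
  (forall x y, Qbar (cpath_jpath x) (cpath_jpath y) = Q x y) /\
  forall (xi_ eta_ : nat -> cpath T n) (xi eta : jpath t),
    (exists M, forall k, `|xi_ k| <= M) ->
    (exists M, forall k, `|eta_ k| <= M) ->
    (forall s, xi_ k s @[k --> \oo] --> jpath_fun xi s) ->
    (forall s, eta_ k s @[k --> \oo] --> jpath_fun eta s) ->
    Q (xi_ k) (eta_ k) @[k --> \oo] --> Qbar xi eta.

End jump.
Arguments jpath {R T} n t.

(* Main.v *)
Require Import Defs.
From HB Require Import structures.
From mathcomp Require Import all_boot all_order all_algebra.
From mathcomp Require Import all_classical all_reals all_analysis.
From mathcomp Require Import ring lra.
Set Implicit Arguments.
Unset Strict Implicit.
Unset Printing Implicit Defensive.
Import Order.TTheory GRing.Theory Num.Theory.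
Import numFieldNormedType.Exports.
Local Open Scope classical_set_scope.
Local Open Scope ring_scope.

(** The derivatives of [Phi] enter only as a bounded linear form and a bounded
bilinear form on [C], the space of continuous paths; every such form has a
unique weakly continuous extension to [C (+) B_t].

The element [xi = x + v 1_{t}] is the pointwise limit of the bounded sequence
of paths [jpath_approx k xi = x + tent_k v], where [tent_k] is the tent of
height 1 and width [1/k] around [t].  A weakly continuous extension of a
bilinear form [Q] can therefore only be
[Qbar xi eta = lim_k Q (jpath_approx k xi) (jpath_approx k eta)], which gives
uniqueness.  Existence of the limit, and weak continuity of [Qbar], both reduce
to one statement ([bilinear_cvg0]): if [x_k] is bounded and tends to 0
pointwise, and [y_k] is merely bounded, then [Q x_k y_k] tends to 0.  For
instance, were the sequence defining [Qbar] not Cauchy, differences taken along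
two subsequences would contradict it.  A linear form [L] is handled through
the bilinear form [L x * y_i(t)], by freezing [y] at the constant path 1.

With measures, [bilinear_cvg0] would be dominated convergence combined with
Grothendieck's inequality.  Here it is proved without measures, in two steps.

The first is exhaustivity ([bilinear_exhaustive]): if [sum_(j < N) |x_j| <= M]
pointwise and all [|y_j| <= 1], some [|Q x_j y_j|] is small as soon as [N] is
large.  For signs [r_j], consider the Riesz product, taken coordinatewise,
[V = Im (prod_j (1 + i r_j b y_j))] with [b = 1 / sqrt N].  Its coordinates are
at most [(1 + 1/N)^(N/2) <= sqrt e] in modulus, and the mean of [r_j V] over all
signs is exactly [b y_j].  Hence the mean of [Q (sum_j r_j x_j) V] is
[b * sum_j Q x_j y_j], while each of its values is bounded by a constant times
[M]; so [sum_j Q x_j y_j] is at most a constant times [M sqrt N].  The mean is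
avoided by choosing the signs one at a time ([riesz_product]).

The second is the classical passage from exhaustivity to bounded convergence
([small_below_cvg0]).  Call [f] small when [Q x y] is small for all
[|x| <= f] and [|y| <= 1].  Exhaustivity says that increments of a bounded
increasing sequence become small.  Applied to the running maxima
[max (f_i, ..., f_m)], with [f_k = |x_k|], it yields continuous functions [g_i]
that tend to 0 and dominate each later [f_k] up to an error of size
[e 2^-i].  The running minima of the [g_i] decrease to 0, uniformly by Dini's
theorem, and still dominate [f_k] up to the sum of these errors. *)

(** * Norms of row vectors and of paths *)

Section row_norms.
Context {R : realType} {n : nat}.
Implicit Types v : 'rV[R]_n.

Lemma coord_le_norm v i : `|v 0 i| <= `|v|.
Proof.
by rewrite [leRHS]mx_normrE; apply/bigmax_geP; right; exists (0, i).
Qed.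

Lemma row_norm_le v (M : R) : 0 <= M -> (forall i, `|v 0 i| <= M) -> `|v| <= M.
Proof.
move=> M0 vM; rewrite [leLHS]mx_normrE; apply: bigmax_le => // -[i j] _ /=.
by rewrite (ord1 i).
Qed.

Lemma coord_le_enorm v i : `|v 0 i| <= enorm v.
Proof.
rewrite /enorm -sqrtr_sqr ler_sqrt ?sum_sqr_ge0// (bigD1 i)//= lerDl.
by apply: sumr_ge0 => j _; exact: sqr_ge0.
Qed.

Lemma norm_le_enorm v : `|v| <= enorm v.
Proof. by apply: row_norm_le (enorm_ge0 v) (coord_le_enorm v). Qed.

End row_norms.

Section continuity.
Context {R : realType} (X : topologicalType).
Implicit Types f g : X -> R.

Lemma maxf_continuous f g :
  continuous f -> continuous g -> continuous (fun u => Num.max (f u) (g u)).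
Proof. by move=> cf cg u; exact: continuous_max (cf u) (cg u). Qed.

Lemma minf_continuous f g :
  continuous f -> continuous g -> continuous (fun u => Num.min (f u) (g u)).
Proof. by move=> cf cg u; exact: continuous_min (cf u) (cg u). Qed.

Lemma oppf_continuous f : continuous f -> continuous (fun u => - f u).
Proof. by move=> cf u; exact: cvgN (cf u). Qed.

Lemma subf_continuous f g :
  continuous f -> continuous g -> continuous (fun u => f u - g u).
Proof. by move=> cf cg u; exact: cvgB (cf u) (cg u). Qed.

Lemma mulf_continuous f g :
  continuous f -> continuous g -> continuous (fun u => f u * g u).
Proof. by move=> cf cg u; exact: cvgM (cf u) (cg u). Qed.

Lemma normf_continuous f : continuous f -> continuous (fun u => `|f u|).
Proof. by move=> cf u; exact: cvg_norm (cf u). Qed.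

End continuity.

Section paths.
Context {R : realType} {T : R} {n : nat}.
Local Notation C := (cpath T n).
Implicit Types (x y : C) (s : time T).

Lemma cpath_norm_le x (M : R) : 0 <= M -> (forall s, `|x s| <= M) ->
  `|x| <= Num.sqrt n%:R * M.
Proof.
move=> M0 xM; rewrite cpath_normE; apply: supnorm_le => [|s].
  by rewrite mulr_ge0 ?sqrtr_ge0.
rewrite -[in leRHS](ger0_norm M0) -sqrtr_sqr -sqrtrM ?ler0n//.
by apply: enorm_le_mx => // i; apply: le_trans (xM s); exact: coord_le_norm.
Qed.

Lemma norm_le_cpath_norm x s : `|x s| <= `|x|.
Proof. by apply: le_trans (norm_le_enorm _) _; exact: enorm_le_supnorm. Qed.

Lemma row_continuous (X : topologicalType) (f : 'I_n -> X -> R) :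
  (forall i, continuous (f i)) -> continuous (fun u => \row_i f i u).
Proof.
move=> cf u A [P Pu PA]; rewrite /nbhs/=.
have : \forall w \near u, forall i, P 0 i (f i w).
  apply: filter_forall => i; apply: cf.
  by have := Pu 0 i; rewrite mxE.
by apply: filterS => w wP; apply: PA => i j /=; rewrite mxE (ord1 i); exact: wP.
Qed.

Definition path_of_coords (f : 'I_n -> time T -> R)
    (cf : forall i, continuous (f i)) : C.
Proof.
exists (fun s => \row_i f i s).
by rewrite inE; exact: row_continuous cf.
Defined.

Lemma path_of_coordsE f cf s i : (@path_of_coords f cf s) 0 i = f i s.
Proof. by rewrite mxE. Qed.

Lemma cpath_coord_continuous x i : continuous (fun s => x s 0 i).
Proof.
move=> s; apply: (@continuous_comp _ _ _ x (fun v : 'rV[R]_n => v 0 i)).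
  exact: cpath_continuous.
exact: coord_continuous.
Qed.

Lemma cpath_norm_continuous x : continuous (fun s => `|x s| : R).
Proof.
move=> s; apply: (@continuous_comp _ _ _ x (fun v : 'rV[R]_n => `|v|)).
  exact: cpath_continuous.
exact: norm_continuous.
Qed.

Lemma cpathD_coord x y s i : (x + y : C) s 0 i = x s 0 i + y s 0 i.
Proof. by rewrite cpathDE mxE. Qed.

Lemma cpathZ_coord a x s i : (a *: x : C) s 0 i = a * x s 0 i.
Proof. by rewrite cpathZE mxE. Qed.

Fact coord_mul_continuous x y i : continuous (fun s => x s 0 i * y s 0 i).
Proof. by apply: mulf_continuous; exact: cpath_coord_continuous. Qed.

Definition coord_mul x y : C := path_of_coords (@coord_mul_continuous x y).

Lemma coord_mulE x y s i : coord_mul x y s 0 i = x s 0 i * y s 0 i.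
Proof. exact: path_of_coordsE. Qed.

Lemma coord_mulDr x y z : coord_mul x (y + z) = coord_mul x y + coord_mul x z.
Proof.
by apply: cpath_ext => s; apply/rowP => i; rewrite !(mxE, cpathDE) mulrDr.
Qed.

Lemma coord_mulZr a x y : coord_mul x (a *: y) = a *: coord_mul x y.
Proof.
by apply: cpath_ext => s; apply/rowP => i; rewrite !(mxE, cpathZE) mulrCA.
Qed.

Definition const_path (v : 'rV[R]_n) : C :=
  path_of_coords (fun i => @cst_continuous (time T) R (v 0 i)).

Lemma const_pathE v s : const_path v s = v.
Proof. by apply/rowP => i; rewrite mxE. Qed.

(** The identity of the subtype, extended arbitrarily outside [[0, T]], exhibits
it as a continuous image of the compact interval. *)
Lemma time_compact : compact [set: time T].
Proof.
have [T0|T0] := ltP T 0.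
  have -> : [set: time T] = set0; last exact: compact0.
  apply/seteqP; split=> // -[s sT] _; have := sT.
  by rewrite inE/= in_itv/= => /andP[s0 /(le_trans s0)]; rewrite leNgt T0.
have z : time T by exists 0; rewrite inE/= in_itv/= lexx.
have cz : {within `[0, T], continuous (@valL_ _ _ z `[0, T] (@id (time T)))}.
  by apply/subspace_valL_continuousP' => s; exact: cvg_id.
have := continuous_compact cz (@segment_compact R 0 T).
congr compact; apply/seteqP; split=> // s _.
exists (set_val s); first exact: set_valP.
exact: (congr1 (@^~ s) (@valLK _ _ z `[0, T] id)).
Qed.

Lemma dini (h : nat -> time T -> R) (e : R) :
  (forall k, continuous (h k)) ->
  (forall k s, h k.+1 s <= h k s) ->
  (forall s, exists k, h k s < e) ->
  exists k, forall s, h k s < e.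
Proof.
move=> ch dh h_e.
have h_le s : {homo h^~ s : a b / (a <= b)%N >-> b <= a}.
  by apply: homo_leq => // b a c ba cb; exact: le_trans cb ba.
have /compact_near_coveringP cov := time_compact.
have := cov nat \oo (fun k s => h k s < e).
case=> [s _|N _ hN]; last by exists N => s; apply: hN => //=.
have [k hk] := h_e s; near=> s' j => /=.
apply: (@le_lt_trans _ _ (h k s')); first by apply: h_le; near: j; exists k.
by near: s'; exact: cvgr_lt (ch k s) _ hk.
Unshelve. all: by end_near. Qed.

End paths.

(** * Bilinear forms *)

Section bilinear.
Context {R : realType} (E : normedModType R).
Implicit Types (Q : bidual E) (x y : E).

Lemma bidualDl Q x x' y : Q (x + x') y = Q x y + Q x' y.
Proof. exact: (Defs.scalarP (bidual_linearl Q y)).1. Qed.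

Lemma bidualZl Q a x y : Q (a *: x) y = a * Q x y.
Proof. exact: (Defs.scalarP (bidual_linearl Q y)).2. Qed.

Lemma bidualDr Q x y y' : Q x (y + y') = Q x y + Q x y'.
Proof. exact: (Defs.scalarP (bidual_linearr Q x)).1. Qed.

Lemma bidualZr Q a x y : Q x (a *: y) = a * Q x y.
Proof. exact: (Defs.scalarP (bidual_linearr Q x)).2. Qed.

Lemma bidualBl Q x x' y : Q (x - x') y = Q x y - Q x' y.
Proof. by rewrite bidualDl -scaleN1r bidualZl mulN1r. Qed.

Lemma bidualBr Q x y y' : Q x (y - y') = Q x y - Q x y'.
Proof. by rewrite bidualDr -scaleN1r bidualZr mulN1r. Qed.

Lemma bidual_bound Q :
  exists2 K : R, 0 < K & forall x y, `|Q x y| <= K * `|x| * `|y|.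
Proof.
have [M QM] := bidual_bounded Q; exists (`|M| + 1); first by rewrite ltr_wpDl.
move=> x y; apply: le_trans (QM x y) _.
rewrite -!mulrA ler_wpM2r ?mulr_ge0//.
by apply: le_trans (ler_norm M) _; rewrite lerDl.
Qed.

Definition bidual_swap Q : bidual E.
Proof.
apply: (@Bidual _ _ (fun x y => Q y x)).
- exact: bidual_linearr.
- exact: bidual_linearl.
- have [M QM] := bidual_bounded Q; exists M => x y.
  by rewrite mulrAC; exact: QM.
Defined.

End bilinear.

(** * Riesz products and exhaustivity of bilinear forms *)

Section riesz_products.
Context {R : realType} {T : R} {n : nat}.
Local Notation C := (cpath T n).
Implicit Types (Q : bidual C) (s : time T).

Let antipodal_sum (a c : R) : a + - 1 * c + (a + - -1 * c) = a * 2.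
Proof. by ring. Qed.

Let antipodal_sum2 (a c d e f : R) :
  (a + 1 * c + (1 * d + 1 * (1 * e))) +
  (a + -1 * c + (-1 * d + -1 * (-1 * e))) + f * 2 = (a + (e + f)) * 2.
Proof. by ring. Qed.

Let sign_above_average (w : R -> R) (a : R) :
  w 1 + w (-1) = a * 2 -> exists2 r : R, `|r| = 1 & a <= w r.
Proof.
move=> wa; have [w1|w1] := leP (w (-1)) (w 1).
  by exists 1; rewrite ?normr1//; lra.
by exists (-1); rewrite ?normrN1//; lra.
Qed.

(** Multiplying [u + i v] by [1 + i r c] multiplies its squared modulus by
[1 + c^2]. *)
Let sqr_rotation (r c u v u' v' : R) : `|r| = 1 ->
  u' = u + - r * (c * v) -> v' = v + r * (c * u) ->
  u' ^+ 2 + v' ^+ 2 = (u ^+ 2 + v ^+ 2) * (1 + c ^+ 2).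
Proof.
move=> r1 -> ->; transitivity ((u ^+ 2 + v ^+ 2) * (1 + r ^+ 2 * c ^+ 2)).
  by ring.
by rewrite -(real_normK (num_real r)) r1 expr1n mul1r.
Qed.

(** One factor of the product: [U + i V] becomes [(U + i V) (1 + i r y)] and [X]
becomes [X + r x], coordinatewise, for a sign [r].  The potential
[Q X V + sum_p Q p.1 (p.2 U)] is the mean of the final [Q X V] over the signs
still to be chosen: averaged over [r], the term [Q (r x) (r y U)] replaces the
summand of [(x, y)] and all terms of odd degree in [r] cancel.  Hence one of the
two signs does not decrease it. *)
Lemma riesz_product_step Q (l : seq (C * C)) (x y X U V : C) :
  exists X' U' V' : C, [/\
    forall s, `|X' s| <= `|X s| + `|x s|,
    forall s i, U' s 0 i ^+ 2 + V' s 0 i ^+ 2 =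
      (U s 0 i ^+ 2 + V s 0 i ^+ 2) * (1 + y s 0 i ^+ 2) &
    Q X V + \sum_(p <- (x, y) :: l) Q p.1 (coord_mul p.2 U) <=
    Q X' V' + \sum_(p <- l) Q p.1 (coord_mul p.2 U')].
Proof.
pose Ur (r : R) := U + (- r) *: coord_mul y V.
pose Vr (r : R) := V + r *: coord_mul y U.
pose Xr (r : R) := X + r *: x.
pose W (r : R) := Q (Xr r) (Vr r) + \sum_(p <- l) Q p.1 (coord_mul p.2 (Ur r)).
have avgW : W 1 + W (-1) = (Q X V + \sum_(p <- (x, y) :: l)
    Q p.1 (coord_mul p.2 U)) * 2.
  rewrite /W addrACA -big_split/= big_cons/=.
  under eq_bigr do
    rewrite /Ur !coord_mulDr !coord_mulZr !bidualDr !bidualZr antipodal_sum.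
  rewrite -mulr_suml /Xr /Vr !(bidualDl, bidualDr, bidualZl, bidualZr).
  exact: antipodal_sum2.
have [r rr WX] := sign_above_average avgW.
exists (Xr r), (Ur r), (Vr r); split=> [s|s i|//].
  apply: le_trans (ler_normD _ _) _; rewrite lerD2l.
  by rewrite [X in `|X|]cpathZE normrZ rr mul1r.
have UE : Ur r s 0 i = U s 0 i + - r * (y s 0 i * V s 0 i).
  by rewrite -coord_mulE -cpathZ_coord -cpathD_coord.
have VE : Vr r s 0 i = V s 0 i + r * (y s 0 i * U s 0 i).
  by rewrite -coord_mulE -cpathZ_coord -cpathD_coord.
exact: sqr_rotation rr UE VE.
Qed.

(** Starting from [X = 0], [U = 1], [V = 0], the resulting [V'] is the imaginary
part of the product of the [1 + i r_p p.2], and [X'] the sum of the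
[r_p p.1]. *)
Lemma riesz_product Q (b : R) (l : seq (C * C)) (X U V : C) :
  (forall p s, p \in l -> `|p.2 s| <= b) ->
  exists X' V' : C, [/\
    forall s, `|X' s| <= `|X s| + \sum_(p <- l) `|p.1 s|,
    forall s i, V' s 0 i ^+ 2 <=
      (U s 0 i ^+ 2 + V s 0 i ^+ 2) * (1 + b ^+ 2) ^+ size l &
    Q X V + \sum_(p <- l) Q p.1 (coord_mul p.2 U) <= Q X' V'].
Proof.
elim: l X U V => [|[x y] l IH] X U V lb.
  exists X, V; split=> [s|s i|]; rewrite ?big_nil ?addr0//=.
  by rewrite expr0 mulr1 lerDr sqr_ge0.
have yb s i : `|y s 0 i| <= b.
  apply: le_trans (coord_le_norm _ _) _.
  by apply: (lb (x, y)); rewrite mem_head.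
have {}lb p s : p \in l -> `|p.2 s| <= b.
  by move=> pl; apply: lb; rewrite inE pl orbT.
have [X1 [U1 [V1 [X1X UV1 Q1]]]] := riesz_product_step Q l x y X U V.
have [X' [V' [X'X V'V QX'V']]] := IH X1 U1 V1 lb.
exists X', V'; split; last exact: le_trans Q1 QX'V'.
  move=> s; rewrite big_cons/= addrA; apply: le_trans (X'X s) _.
  by rewrite lerD2r.
move=> s i; apply: le_trans (V'V s i) _.
rewrite UV1 [size _]/= (exprS (1 + b ^+ 2)) mulrA.
rewrite ler_wpM2r ?exprn_ge0 ?addr_ge0 ?sqr_ge0//.
rewrite ler_wpM2l ?addr_ge0 ?sqr_ge0// lerD2l -real_normK ?num_real//.
by rewrite lerXn2r ?nnegrE// (le_trans _ (yb s i)).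
Qed.

(** The hypothesis [size l * b^2 <= 1] keeps [(1 + b^2)^(size l)] below [e]. *)
Lemma sum_bilinear_le Q : exists2 K : R, 0 < K &
  forall (b M : R) (l : seq (C * C)), 0 <= M ->
    (size l)%:R * b ^+ 2 <= 1 ->
    (forall s, \sum_(p <- l) `|p.1 s| <= M) ->
    (forall p s, p \in l -> `|p.2 s| <= b) ->
    \sum_(p <- l) Q p.1 p.2 <= K * M.
Proof.
have [K K0 QK] := bidual_bound Q; pose r : R := Num.sqrt n%:R.
have r0 : 0 <= r by exact: sqrtr_ge0.
(* [r + 1] instead of [r] keeps the constant positive when [n = 0]. *)
exists (K * (r + 1) * ((r + 1) * expR 1)).
  by rewrite !mulr_gt0 ?expR_gt0 ?ltr_wpDl.
move=> b M l M0 lb lM l2.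
pose one := const_path (const_mx 1 : 'rV[R]_n) : C.
have [X [V [XM Vb QXV]]] := riesz_product Q 0 one 0 l2.
have {}XM s : `|X s| <= M.
  by apply: le_trans (XM s) _; rewrite normr0 add0r.
have {}Vb s : `|V s| <= expR 1.
  have e1 : 1 <= expR (1 : R) by have := @expR_ge1Dx R 1; lra.
  apply: row_norm_le => [|i]; first exact: expR_ge0.
  rewrite -(@ler_pXn2r _ 2) ?nnegrE ?expR_ge0// real_normK ?num_real//.
  apply: le_trans (Vb s i) _.
  have -> : one s 0 i = 1 by rewrite /one const_pathE mxE.
  have -> : (0 : C) s 0 i = 0 by rewrite mxE.
  rewrite expr1n expr0n/= addr0 mul1r; apply: (@le_trans _ _ (expR 1)).
    apply: (@le_trans _ _ (expR (b ^+ 2) ^+ size l)).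
      by rewrite lerXn2r ?nnegrE ?addr_ge0 ?sqr_ge0 ?expR_ge0// expR_ge1Dx.
    by rewrite -expRM_natl ler_expR.
  by rewrite -[leLHS]mulr1 expr2 ler_wpM2l ?expR_ge0.
have -> : \sum_(p <- l) Q p.1 p.2 =
    Q 0 0 + \sum_(p <- l) Q p.1 (coord_mul p.2 one).
  rewrite -[X in Q X 0](scale0r 0) bidualZl mul0r add0r.
  apply: eq_bigr => p _; congr (Q _ _).
  apply: cpath_ext => s; apply/rowP => i.
  by rewrite coord_mulE const_pathE mxE mulr1.
apply: le_trans QXV _; apply: le_trans (ler_norm _) _.
apply: le_trans (QK X V) _.
have -> : K * (r + 1) * ((r + 1) * expR 1) * M =
    K * ((r + 1) * M) * ((r + 1) * expR 1) by ring.
apply: ler_pM; rewrite ?mulr_ge0 ?(ltW K0)//.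
  rewrite ler_wpM2l ?(ltW K0)//; apply: le_trans (cpath_norm_le M0 XM) _.
  by rewrite ler_wpM2r// lerDl.
apply: le_trans (cpath_norm_le (expR_ge0 1) Vb) _.
by rewrite ler_wpM2r ?expR_ge0// lerDl.
Qed.

(** Take [N = m^2] pairs.  Dividing the [y_j] by [m] makes [sum_bilinear_le]
applicable, so that [sum_j |Q x_j y_j| <= K M m]; if every term exceeded [d],
the sum would exceed [m^2 d]. *)
Lemma bilinear_exhaustive Q (d M : R) : 0 < d -> 0 <= M -> exists N : nat,
  forall x y : nat -> C,
    (forall s, \sum_(j < N) `|x j s| <= M) ->
    (forall j s, `|y j s| <= 1) ->
  exists2 j, (j < N)%N & `|Q (x j) (y j)| <= d.
Proof.
move=> d0 M0; have [K K0 QK] := sum_bilinear_le Q.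
have [m mP] : exists m : nat, K * M / d < m.+1%:R.
  exists (Num.truncn (K * M / d)).
  exact: truncnS_gt.
exists (m.+1 ^ 2)%N => x y xM y1; apply: contrapT => H.
have {}H j : (j < m.+1 ^ 2)%N -> d < `|Q (x j) (y j)|.
  by move=> jN; rewrite ltNge; apply/negP => Qd; apply: H; exists j.
pose l := [seq (Num.sg (Q (x j) (y j)) *: x j, m.+1%:R^-1 *: y j)
  | j <- iota 0 (m.+1 ^ 2)].
have sl : size l = (m.+1 ^ 2)%N by rewrite size_map size_iota.
have m0 : 0 < m.+1%:R :> R by rewrite ltr0n.
have : \sum_(p <- l) Q p.1 p.2 <= K * M.
  apply: (QK m.+1%:R^-1 M l M0); last first.
  - move=> p s /mapP[j _ ->] /=.
    rewrite [X in `|X|]cpathZE normrZ gtr0_norm ?invr_gt0//.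
    by rewrite ler_piMr// invr_ge0 ltW.
  - move=> s; rewrite big_map -[iota _ _]/(index_iota 0 (m.+1 ^ 2)) big_mkord.
    apply: le_trans (xM s); apply: ler_sum => j _ /=.
    rewrite [X in `|X|]cpathZE normrZ ler_piMl// normr_sg.
    by case: (_ != 0).
  by rewrite sl natrX -exprMn mulfV ?gt_eqF// expr1n.
apply/negP; rewrite -ltNge big_map.
rewrite -[iota _ _]/(index_iota 0 (m.+1 ^ 2)) big_mkord.
apply: (@lt_le_trans _ _ (\sum_(j < m.+1 ^ 2) (m.+1%:R^-1 * d))); last first.
  apply: ler_sum => j _ /=; rewrite bidualZl bidualZr mulrCA -normrEsg.
  by rewrite ler_wpM2l ?invr_ge0 ?(ltW m0)// ltW// H.
rewrite sumr_const card_ord -[ltRHS]mulr_natr natrX.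
have -> : m.+1%:R^-1 * d * m.+1%:R ^+ 2 = m.+1%:R * d :> R.
  by field; rewrite gt_eqF.
by rewrite -ltr_pdivrMr.
Qed.

End riesz_products.

(** * Bounded convergence for bilinear forms *)

Section bounded_convergence.
Context {R : realType} {T : R} {n : nat}.
Local Notation C := (cpath T n).
Implicit Types (Q : bidual C) (s : time T) (f g h : time T -> R).

(** The supremum of [|Q x y|] over these [x] and [y], as a function of [f],
plays the role of an outer measure dominating [Q]. *)
Definition small_below Q f (e : R) : Prop := forall x y : C,
  (forall s, `|x s| <= f s) -> (forall s, `|y s| <= 1) -> `|Q x y| <= e.

Lemma small_below_le Q f g (d e : R) : (forall s, f s <= g s) -> d <= e ->
  small_below Q g d -> small_below Q f e.
Proof.
move=> fg de gd x y xf y1; apply: le_trans de; apply: gd => // s.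
exact: le_trans (xf s) (fg s).
Qed.

Fact clamp_continuous f (x : C) i : continuous f ->
  continuous (fun s => Num.max (- f s) (Num.min (f s) (x s 0 i))).
Proof.
move=> cf; apply: maxf_continuous; first exact: oppf_continuous.
by apply: minf_continuous => //; exact: cpath_coord_continuous.
Qed.

(** A path below [f + g] splits into its truncation at height [f], coordinate by
coordinate, and a remainder below [g]; continuity of [f] makes the truncation
continuous. *)
Lemma small_belowD Q f g (a b : R) : continuous f ->
  (forall s, 0 <= f s) -> (forall s, 0 <= g s) ->
  small_below Q f a -> small_below Q g b ->
  small_below Q (fun s => f s + g s) (a + b).
Proof.
move=> cf f0 g0 fa gb x y xfg y1.
pose x1 : C := path_of_coords (fun i => @clamp_continuous f x i cf).
have -> : x = x1 + (x - x1) by rewrite addrC subrK.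
rewrite bidualDl; apply: le_trans (ler_normD _ _) _; apply: lerD.
  apply: fa => // s; apply: row_norm_le => // i.
  rewrite path_of_coordsE ler_norml le_max lexx/=.
  by rewrite ge_max ge_min lexx/= andbT; have := f0 s; lra.
apply: gb => // s; apply: row_norm_le => // i.
have -> : (x - x1 : C) s 0 i = x s 0 i - x1 s 0 i.
  by rewrite cpathD_coord mxE.
rewrite path_of_coordsE; have := le_trans (coord_le_norm (x s) i) (xfg s).
move: (x s 0 i) (f0 s) (g0 s) => z fs gs; rewrite !ler_norml => /andP[z1 z2].
rewrite /Num.max /Num.min; case: (ltP (f s) z) => zf;
  by case: (ltP (- f s) _) => fz; apply/andP; split; lra.
Qed.

Lemma small_below_cst Q :
  exists2 K : R, 0 < K &
    forall c : R, 0 <= c -> small_below Q (fun=> c) (K * c).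
Proof.
have [K K0 QK] := bidual_bound Q; pose r : R := Num.sqrt n%:R + 1.
have r0 : 0 < r by rewrite ltr_wpDl ?sqrtr_ge0.
exists (K * r * r) => [|c c0 x y xc y1]; first by rewrite !mulr_gt0.
apply: le_trans (QK x y) _; rewrite -!mulrA ler_wpM2l ?(ltW K0)//.
have xr : `|x| <= r * c.
  by apply: le_trans (cpath_norm_le c0 xc) _; rewrite ler_wpM2r// lerDl.
have yr : `|y| <= r.
  apply: le_trans (cpath_norm_le ler01 y1) _.
  by rewrite mulr1 lerDl.
rewrite [leRHS]mulrCA [leRHS]mulrC -mulrA [c * r]mulrC.
by rewrite mulrC; apply: ler_pM.
Qed.

(** Otherwise a chain of indices would have successive increments that are not
small, with witnesses whose norms add up to at most [M] by telescoping, against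
exhaustivity. *)
Lemma small_below_increments Q (g : nat -> time T -> R) (M d : R) : 0 < d ->
  (forall m s, 0 <= g m s <= M) ->
  exists N, forall m, small_below Q (fun s => g m s - g N s) d.
Proof.
move=> d0 gM; apply: contrapT => noN.
have step N : exists p : nat * (C * C), [/\
    forall s, `|p.2.1 s| <= g p.1 s - g N s,
    forall s, `|p.2.2 s| <= 1 & d < `|Q p.2.1 p.2.2|].
  apply: contrapT => noP; apply: noN; exists N => m x y xg y1.
  by rewrite leNgt; apply/negP => dQ; apply: noP; exists (m, (x, y)).
have {step}[p pP] := choice step.
pose u j := iter j (fun N => (p N).1) 0%N.
have [N QN] := bilinear_exhaustive Q d0 (normr_ge0 M).
have [s|j s|j _] := QN (fun j => (p (u j)).2.1) (fun j => (p (u j)).2.2).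
- apply: (@le_trans _ _ (\sum_(j < N) (g (u j.+1) s - g (u j) s))).
    by apply: ler_sum => j _; have [+ _ _] := pP (u j); exact.
  rewrite -(big_mkord xpredT (fun j => g (u j.+1) s - g (u j) s)).
  rewrite telescope_sumr//.
  have /andP[_ gN] := gM (u N) s; have /andP[g0 _] := gM (u 0%N) s.
  by have := ler_norm M; lra.
- by have [_ + _] := pP (u j); exact.
- by have [_ _ +] := pP (u j); rewrite ltNge => /negP.
Qed.

Fixpoint running_max (f : nat -> time T -> R) p s : R :=
  if p is q.+1 then Num.max (running_max f q s) (f p s) else f 0%N s.

Fixpoint running_min (f : nat -> time T -> R) p s : R :=
  if p is q.+1 then Num.min (running_min f q s) (f p s) else f 0%N s.

Lemma running_max_continuous (f : nat -> time T -> R) p :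
  (forall j, continuous (f j)) -> continuous (running_max f p).
Proof. by move=> cf; elim: p => [|p IH] //=; exact: maxf_continuous. Qed.

Lemma running_min_continuous (f : nat -> time T -> R) p :
  (forall j, continuous (f j)) -> continuous (running_min f p).
Proof. by move=> cf; elim: p => [|p IH] //=; exact: minf_continuous. Qed.

Lemma le_running_max (f : nat -> time T -> R) j p s :
  (j <= p)%N -> f j s <= running_max f p s.
Proof.
elim: p => [|p IH]; first by rewrite leqn0 => /eqP ->.
by rewrite leq_eqVlt => /predU1P[->|/IH fj]; rewrite /= le_max ?lexx ?orbT// fj.
Qed.

Lemma running_max_le (f : nat -> time T -> R) p s (M : R) :
  (forall j, f j s <= M) -> running_max f p s <= M.
Proof. by move=> fM; elim: p => [|p IH] //=; rewrite ge_max IH fM. Qed.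

Lemma running_min_ge (f : nat -> time T -> R) p s (m : R) :
  (forall j, m <= f j s) -> m <= running_min f p s.
Proof. by move=> fm; elim: p => [|p IH] //=; rewrite le_min IH fm. Qed.

Lemma running_min_le (f : nat -> time T -> R) p s : running_min f p s <= f p s.
Proof. by case: p => [|p] //=; rewrite ge_min lexx orbT. Qed.

(** For fixed [i], the [f_j] with [j >= i] lie below [g i] up to an error of
order [2^-i], by exhaustivity; so they lie below the minimum [h k] of
[g 0, ..., g k], when [j >= k], up to the sum of these errors.  Since [f_k]
tends to 0, so do [g_i] and [h k], and [h k] decreases: Dini's theorem makes
[h k] uniformly small. *)
Lemma small_below_cvg0 Q (f : nat -> time T -> R) (M : R) :
  (forall k, continuous (f k)) -> (forall k s, 0 <= f k s <= M) ->
  (forall s, f k s @[k --> \oo] --> (0 : R)) ->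
  forall e : R, 0 < e ->
  exists N, forall k, (N <= k)%N -> small_below Q (f k) e.
Proof.
move=> cf fM f0 e e0.
(* [G i p] is the maximum of [f_i, ..., f_(i + p)]. *)
pose G i p s := running_max (fun j => f (i + j)%N) p s.
have f_le_G i j p s : (i <= j <= i + p)%N -> f j s <= G i p s.
  case/andP=> ij jp; rewrite -(subnKC ij).
  by apply: (@le_running_max (fun k => f (i + k)%N)); rewrite leq_subLR.
have G_ge0 i p s : 0 <= G i p s.
  have /andP[/le_trans + _] := fM i s; apply.
  by apply: f_le_G; rewrite leqnn leq_addr.
have increments i : exists N, forall m,
    small_below Q (fun s => G i m s - G i N s) (e / 2 / 2 ^+ i.+1).
  apply: (@small_below_increments Q (G i) M).
    by rewrite !divr_gt0 ?exprn_gt0.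
  move=> m s; rewrite G_ge0/=.
  by apply: running_max_le => j; have /andP[] := fM (i + j)%N s.
have {increments}[N NP] := choice increments.
(* No [G i m] exceeds [g i] by more than a small amount. *)
pose g i := G i (N i); pose h := running_min g.
have cg i : continuous (g i).
  by apply: running_max_continuous => j; exact: cf.
have ch i : continuous (h i) by exact: running_min_continuous.
have h0 i s : 0 <= h i s by apply: running_min_ge => j; exact: G_ge0.
have fg i j : (i <= j)%N ->
    small_below Q (fun s => Num.max 0 (f j s - g i s)) (e / 2 / 2 ^+ i.+1).
  move=> ij; apply: small_below_le (lexx _) (NP i (maxn (j - i) (N i))) => s.
  rewrite ge_max subr_ge0 lerD2r; apply/andP; split.
    apply: (@homo_leq _ (fun p => G i p s) <=%R); rewrite ?leq_maxr//.
      by move=> y x z; exact: le_trans.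
    by move=> p; rewrite /G /= le_max lexx.
  by apply: f_le_G; rewrite ij/= -leq_subLR leq_maxl.
(* The errors [e/2 * 2^-(i+1)], [i <= k], add up to [e/2 * (1 - 2^-(k+1))]. *)
have fh k j : (k <= j)%N -> small_below Q (fun s => Num.max 0 (f j s - h k s))
    (e / 2 * (1 - (2 ^+ k.+1)^-1)).
  elim: k => [_|k IH kj].
    apply: small_below_le (fg 0%N j (leq0n j)) => //.
    by rewrite expr1; lra.
  apply: small_below_le (small_belowD _ _ _ (IH (ltnW kj)) (fg k.+1 j kj)).
  - move=> s; have -> : h k.+1 s = Num.min (h k s) (g k.+1 s) by [].
    move: (f j s) (h k s) (g k.+1 s) => a b c.
    have : [/\ 0 <= Num.max 0 (a - b), a - b <= Num.max 0 (a - b),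
        0 <= Num.max 0 (a - c) & a - c <= Num.max 0 (a - c)].
      by rewrite !le_max !lexx !orbT.
    move: (Num.max 0 (a - b)) (Num.max 0 (a - c)) => p q [p0 pb q0 qc].
    by rewrite ge_max; have [_|_] := leP b c; apply/andP; split; lra.
  - have -> : (2 ^+ k.+2)^-1 = (2 ^+ k.+1)^-1 / 2 :> R.
      by rewrite [in LHS]exprS invfM mulrC.
    by move: ((2 ^+ k.+1)^-1) => u; lra.
  - apply: maxf_continuous; first exact: cst_continuous.
    exact: subf_continuous.
  - by move=> s; rewrite le_max lexx.
  - by move=> s; rewrite le_max lexx.
have [K K0 QK] := small_below_cst Q; pose c := e / 2 / K.
have c0 : 0 < c by rewrite !divr_gt0.
have [k kP] : exists k, forall s, h k s < c.
  apply: dini => // [k s|s]; first by rewrite /h /= ge_min lexx.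
  have [//|k _ kP] := cvgr_lt _ (f0 s) (c / 2); first by rewrite divr_gt0.
  exists k; apply: le_lt_trans (running_min_le _ _ _) _.
  apply: (@le_lt_trans _ _ (c / 2)); last by lra.
  by apply: running_max_le => j; apply/ltW/kP => /=; exact: leq_addr.
exists k => j kj.
apply: small_below_le (small_belowD _ _ _ (fh k j kj) (QK c (ltW c0))).
- move=> s; have := kP s; have : f j s - h k s <= Num.max 0 (f j s - h k s).
    by rewrite le_max lexx orbT.
  by lra.
- have -> : K * c = e / 2 by rewrite /c mulrC divfK// gt_eqF.
  by rewrite [leRHS]splitr lerD2r ger_pMr ?divr_gt0// gerBl.
- apply: maxf_continuous; first exact: cst_continuous.
  exact: subf_continuous.
- by move=> s; rewrite le_max lexx.
- by move=> s; exact: ltW.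
Qed.

(** Smallness of [Q] below [|x_k|] is uniform in the second argument, which is
why no convergence of [y_k] is needed. *)
Lemma bilinear_cvg0 Q (x_ y_ : nat -> C) :
  (exists M, forall k, `|x_ k| <= M) -> (exists M, forall k, `|y_ k| <= M) ->
  (forall s, x_ k s @[k --> \oo] --> (0 : 'rV[R]_n)) ->
  Q (x_ k) (y_ k) @[k --> \oo] --> (0 : R).
Proof.
move=> [M xM] [B yB] x0; pose b := `|B| + 1.
have b0 : 0 < b by rewrite ltr_wpDl.
apply/cvgr0Pnorm_le => e e0.
have [||||N NP] := @small_below_cvg0 Q (fun k s => `|x_ k s|) M _ _ _ (e / b).
- by move=> k; exact: cpath_norm_continuous.
- move=> k s; rewrite normr_ge0/=; apply: le_trans (xM k).
  exact: norm_le_cpath_norm.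
- by move=> s; apply/norm_cvg0P; exact: x0.
- by rewrite divr_gt0.
exists N => // k /= Nk; have -> : y_ k = b *: (b^-1 *: y_ k).
  by rewrite scalerA mulfV ?scale1r// gt_eqF.
rewrite bidualZr normrM gtr0_norm// -ler_pdivlMl// mulrC.
apply: (NP k Nk) => s; first exact: lexx.
rewrite [X in `|X|]cpathZE normrZ gtr0_norm ?invr_gt0//.
rewrite ler_pdivrMl// mulr1; apply: le_trans (norm_le_cpath_norm _ _) _.
by apply: le_trans (yB k) _; apply: le_trans (ler_norm B) _; rewrite lerDl.
Qed.

End bounded_convergence.

(** * Weakly continuous extensions *)

Section extension.
Context {R : realType} {T : R} {n : nat}.
Local Notation C := (cpath T n).
Implicit Types (Q : bidual C) (s t : time T).

(** Split [Q x y - Q x' y'] as [Q (x - x') y + Q x' (y - y')] and apply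
[bilinear_cvg0] to [Q] and to [Q] with its arguments exchanged. *)
Lemma bilinear_cvg_sub Q (x_ x'_ y_ y'_ : nat -> C) :
  (exists M, forall k, `|x_ k| <= M) -> (exists M, forall k, `|x'_ k| <= M) ->
  (exists M, forall k, `|y_ k| <= M) -> (exists M, forall k, `|y'_ k| <= M) ->
  (forall s, x_ k s - x'_ k s @[k --> \oo] --> (0 : 'rV[R]_n)) ->
  (forall s, y_ k s - y'_ k s @[k --> \oo] --> (0 : 'rV[R]_n)) ->
  Q (x_ k) (y_ k) - Q (x'_ k) (y'_ k) @[k --> \oo] --> (0 : R).
Proof.
move=> bx bx' [My yM] [My' y'M] x0 y0.
have sub_bounded (u v : nat -> C) : (exists M, forall k, `|u k| <= M) ->
    (exists M, forall k, `|v k| <= M) -> exists M, forall k, `|u k - v k| <= M.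
  move=> [M uM] [N vN]; exists (M + N) => k.
  by apply: le_trans (ler_normB _ _) _; exact: lerD.
have -> : (fun k => Q (x_ k) (y_ k) - Q (x'_ k) (y'_ k)) =
    (fun k => Q (x_ k - x'_ k) (y_ k) + bidual_swap Q (y_ k - y'_ k) (x'_ k)).
  apply/funext => k; rewrite /= bidualBl bidualBr.
  by rewrite addrA subrK.
rewrite -[X in _ --> X]addr0; apply: cvgD.
- by apply: bilinear_cvg0 => //; [exact: sub_bounded|exists My].
- apply: bilinear_cvg0 => //; apply: sub_bounded; first by exists My.
  by exists My'.
Qed.

(** A sequence that is not Cauchy has two subsequences at distance bounded
below; completeness does the rest. *)
Lemma cvg_subseq_sub (u : nat -> R) :
  (forall p q : nat -> nat, (forall k, k <= p k)%N -> (forall k, k <= q k)%N ->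
    u (p k) - u (q k) @[k --> \oo] --> (0 : R)) -> cvgn u.
Proof.
move=> u0; apply/cauchy_cvgP/cauchy_exP => e e0; apply: contrapT => noc.
have far k : exists m, (k <= m)%N /\ e <= `|u k - u m|.
  apply: contrapT => nom; apply: noc; exists (u k), k => // m /= km.
  rewrite -ball_normE /=; rewrite ltNge; apply/negP => em.
  by apply: nom; exists m.
have {far}[q qP] := choice far.
have := u0 id q (fun=> leqnn _) (fun k => (qP k).1).
move/cvgr0Pnorm_lt => /(_ e e0)[k _ /(_ k (leqnn k))] /=.
by rewrite ltNge (qP k).2.
Qed.

Lemma cvg_along (X : topologicalType) (u : nat -> X) (l : X) (p : nat -> nat) :
  (forall k, k <= p k)%N -> u k @[k --> \oo] --> l ->
  u (p k) @[k --> \oo] --> l.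
Proof.
move=> kp ul A /ul[N _ NA]; exists N => // k /= Nk.
by apply: NA => /=; exact: leq_trans Nk (kp k).
Qed.

Lemma bilinear_is_cvg Q (x_ y_ : nat -> C) (x y : time T -> 'rV[R]_n) :
  (exists M, forall k, `|x_ k| <= M) -> (exists M, forall k, `|y_ k| <= M) ->
  (forall s, x_ k s @[k --> \oo] --> x s) ->
  (forall s, y_ k s @[k --> \oo] --> y s) ->
  cvgn (fun k => Q (x_ k) (y_ k)).
Proof.
move=> [M xM] [N yN] xx yy; apply: cvg_subseq_sub => p q kp kq.
apply: (@bilinear_cvg_sub Q (x_ \o p) (x_ \o q) (y_ \o p) (y_ \o q)).
- by exists M => k; exact: xM.
- by exists M => k; exact: xM.
- by exists N => k; exact: yN.
- by exists N => k; exact: yN.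
- move=> s; rewrite -(subrr (x s)).
  exact: cvgB (cvg_along kp (xx s)) (cvg_along kq (xx s)).
- move=> s; rewrite -(subrr (y s)).
  exact: cvgB (cvg_along kp (yy s)) (cvg_along kq (yy s)).
Qed.

Definition tent t k s : R := Num.max 0 (1 - k%:R * `|val s - val t|).

Lemma tent_ge0 t k s : 0 <= tent t k s.
Proof. by rewrite le_max lexx. Qed.

Lemma tent_le1 t k s : tent t k s <= 1.
Proof. by rewrite ge_max ler01 gerBl mulr_ge0. Qed.

Lemma tent_cvg t s : tent t k s @[k --> \oo] --> (\1_[set t] s : R).
Proof.
have [->|st] := eqVneq s t.
  rewrite indicE mem_set//; apply: cvg_near_cst; near=> k.
  by rewrite /tent subrr normr0 mulr0 subr0; apply/max_idPr.
rewrite indicE memNset; last by move=> /= sE; rewrite sE eqxx in st.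
apply: cvg_near_cst.
have d0 : 0 < `|val s - val t|.
  by rewrite normr_gt0 subr_eq0; apply: contra_neq st => /val_inj.
exists (Num.truncn `|val s - val t|^-1).+1 => // k /= kN.
apply/max_idPl; rewrite subr_le0 -ler_pdivrMr// mul1r.
apply: le_trans (ltW (truncnS_gt _)) _.
by rewrite ler_nat.
Unshelve. all: by end_near. Qed.

Lemma tent_continuous t k : continuous (tent t k).
Proof.
have cv : continuous (val : time T -> R) by exact: initial_continuous.
apply: maxf_continuous; first exact: cst_continuous.
apply: subf_continuous; first exact: cst_continuous.
apply: mulf_continuous; first exact: cst_continuous.
apply: normf_continuous.
exact: subf_continuous cv (@cst_continuous (time T) R (val t)).
Qed.

Definition spike t k (v : 'rV[R]_n) : C :=
  path_of_coords (fun i => mulf_continuous (@tent_continuous t k)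
    (@cst_continuous (time T) R (v 0 i))).

Lemma spikeE t k v s : spike t k v s = tent t k s *: v.
Proof. by apply/rowP => i; rewrite path_of_coordsE mxE. Qed.

Lemma spike_linear t k a v w :
  spike t k (a *: v + w) = a *: spike t k v + spike t k w.
Proof.
apply: cpath_ext => s; rewrite [LHS]spikeE [RHS]cpathDE (cpathZE a) !spikeE.
by rewrite scalerDr !scalerA mulrC.
Qed.

Definition jpath_approx t k (xi : jpath n t) : C := xi.1 + spike t k xi.2.

Lemma jpath_approx_linear t k a (xi eta : jpath n t) :
  jpath_approx k (a *: xi + eta) =
  a *: jpath_approx k xi + jpath_approx k eta.
Proof.
case: xi eta => [x v] [y w].
change ((a *: x + y) + spike t k (a *: v + w) =
  a *: (x + spike t k v) + (y + spike t k w)).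
by rewrite spike_linear scalerDr addrACA.
Qed.

Lemma jpath_approx_cpath t k (x : C) : jpath_approx k (cpath_jpath t x) = x.
Proof.
by apply: cpath_ext => s; rewrite cpathDE spikeE scaler0 addr0.
Qed.

Lemma jpath_approx_le t k (xi : jpath n t) : `|jpath_approx k xi| <= `|xi|.
Proof.
apply: le_trans (ler_normD _ _) _; rewrite jpath_normE lerD2l cpath_normE.
apply: supnorm_le => [|s]; first exact: enorm_ge0.
by rewrite spikeE enormZ ger0_norm ?tent_ge0// ler_piMl ?enorm_ge0 ?tent_le1.
Qed.

Lemma jpath_approx_cvg t (xi : jpath n t) s :
  jpath_approx k xi s @[k --> \oo] --> jpath_fun xi s.
Proof.
rewrite /jpath_fun /jpath_approx.
under eq_fun do rewrite cpathDE spikeE.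
apply: cvgD; first exact: cvg_cst.
exact: cvgZr_tmp (@tent_cvg t s).
Qed.

Lemma jpath_approx_bounded t (xi : jpath n t) :
  exists M, forall k, `|jpath_approx k xi| <= M.
Proof. by exists `|xi| => k; exact: jpath_approx_le. Qed.

Lemma bidual_approx_cvg Q t (xi eta : jpath n t) :
  cvgn (fun k => Q (jpath_approx k xi) (jpath_approx k eta)).
Proof.
exact: bilinear_is_cvg (jpath_approx_bounded xi) (jpath_approx_bounded eta)
  (@jpath_approx_cvg t xi) (@jpath_approx_cvg t eta).
Qed.

Lemma bidual_approx_linearl Q t (eta : jpath n t) :
  scalar (fun xi : jpath n t =>
    limn (fun k => Q (jpath_approx k xi) (jpath_approx k eta))).
Proof.
move=> a xi xi'.
have E : (fun k => Q (jpath_approx k (a *: xi + xi')) (jpath_approx k eta)) =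
    (fun k => a * Q (jpath_approx k xi) (jpath_approx k eta) +
      Q (jpath_approx k xi') (jpath_approx k eta)).
  by apply/funext => k; rewrite jpath_approx_linear; exact: bidual_linearl.
apply: etrans (congr1 (fun u : nat -> R => limn u) E) _.
apply/cvg_lim => //; apply: cvgD; last exact: bidual_approx_cvg.
by apply: cvgMl_tmp; exact: bidual_approx_cvg.
Qed.

Lemma bidual_approx_linearr Q t (xi : jpath n t) :
  scalar (fun eta : jpath n t =>
    limn (fun k => Q (jpath_approx k xi) (jpath_approx k eta))).
Proof.
move=> a eta eta'.
have E : (fun k => Q (jpath_approx k xi) (jpath_approx k (a *: eta + eta'))) =
    (fun k => a * Q (jpath_approx k xi) (jpath_approx k eta) +
      Q (jpath_approx k xi) (jpath_approx k eta')).
  by apply/funext => k; rewrite jpath_approx_linear; exact: bidual_linearr.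
apply: etrans (congr1 (fun u : nat -> R => limn u) E) _.
apply/cvg_lim => //; apply: cvgD; last exact: bidual_approx_cvg.
by apply: cvgMl_tmp; exact: bidual_approx_cvg.
Qed.

Lemma bidual_approx_bounded Q t : exists K : R, forall xi eta : jpath n t,
  `|limn (fun k => Q (jpath_approx k xi) (jpath_approx k eta))| <=
  K * `|xi| * `|eta|.
Proof.
have [K K0 QK] := bidual_bound Q; exists K => xi eta.
have cQ := @bidual_approx_cvg Q t xi eta.
rewrite -lim_norm//; apply: limr_le; first exact: is_cvg_norm cQ.
apply: nearW => k; apply: le_trans (QK _ _) _.
apply: ler_pM; rewrite ?mulr_ge0 ?(ltW K0) ?jpath_approx_le//.
by rewrite ler_wpM2l ?(ltW K0) ?jpath_approx_le.
Qed.

Definition bidual_extension Q t : bidual (jpath n t) :=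
  Bidual (@bidual_approx_linearl Q t) (@bidual_approx_linearr Q t)
    (@bidual_approx_bounded Q t).

Lemma bidual_extension_cvg Q t (xi eta : jpath n t) :
  Q (jpath_approx k xi) (jpath_approx k eta) @[k --> \oo] -->
  bidual_extension Q t xi eta.
Proof. exact: bidual_approx_cvg. Qed.

Lemma bidual_extension_weakly_continuous Q t :
  weakly_continuous_biextension Q (bidual_extension Q t).
Proof.
split=> [x y|x_ y_ xi eta bx byy xxi yeta].
  apply/cvg_lim => //; under eq_fun do rewrite !jpath_approx_cpath.
  exact: cvg_cst.
have := bilinear_cvg_sub Q bx (jpath_approx_bounded xi) byy
  (jpath_approx_bounded eta).
move=> sub0; rewrite -[X in _ --> X]add0r.
have -> : (fun k => Q (x_ k) (y_ k)) = (fun k =>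
    Q (x_ k) (y_ k) - Q (jpath_approx k xi) (jpath_approx k eta) +
    Q (jpath_approx k xi) (jpath_approx k eta)).
  by apply/funext => k; rewrite subrK.
apply: cvgD; last exact: bidual_extension_cvg.
apply: sub0 => s.
- rewrite -(subrr (jpath_fun xi s)).
  exact: cvgB (xxi s) (@jpath_approx_cvg t xi s).
- rewrite -(subrr (jpath_fun eta s)).
  exact: cvgB (yeta s) (@jpath_approx_cvg t eta s).
Qed.

Lemma weakly_continuous_biextension_unique Q t (Q1 Q2 : bidual (jpath n t)) :
  weakly_continuous_biextension Q Q1 -> weakly_continuous_biextension Q Q2 ->
  Q1 = Q2.
Proof.
move=> [_ Q1c] [_ Q2c]; apply: bidual_ext => xi eta.
have c1 := Q1c _ _ xi eta (jpath_approx_bounded xi) (jpath_approx_bounded eta)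
  (@jpath_approx_cvg t xi) (@jpath_approx_cvg t eta).
have c2 := Q2c _ _ xi eta (jpath_approx_bounded xi) (jpath_approx_bounded eta)
  (@jpath_approx_cvg t xi) (@jpath_approx_cvg t eta).
exact: etrans (esym (cvg_lim (@Rhausdorff R) c1)) (cvg_lim (@Rhausdorff R) c2).
Qed.

Lemma weakly_continuous_extension_unique (L : dual C) t
    (L1 L2 : dual (jpath n t)) :
  weakly_continuous_extension L L1 -> weakly_continuous_extension L L2 ->
  L1 = L2.
Proof.
move=> [_ L1c] [_ L2c]; apply: dual_ext => xi.
have c1 := L1c _ xi (jpath_approx_bounded xi) (@jpath_approx_cvg t xi).
have c2 := L2c _ xi (jpath_approx_bounded xi) (@jpath_approx_cvg t xi).
exact: etrans (esym (cvg_lim (@Rhausdorff R) c1)) (cvg_lim (@Rhausdorff R) c2).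
Qed.

(** Carries the bilinear results over to [L]: freezing [y] at a path whose
coordinate [i] is 1 at time [s] gives back [L]. *)
Definition dual_tensor_eval (L : dual C) s (i : 'I_n) : bidual C.
Proof.
apply: (@Bidual _ _ (fun x y => L x * y s 0 i)).
- by move=> y a x x'; rewrite dual_linear mulrDl mulrA.
- by move=> x a y y'; rewrite cpathD_coord cpathZ_coord; ring.
- have [M LM] := dual_bounded L; exists M => x y; rewrite normrM.
  apply: ler_pM => //; apply: le_trans (coord_le_norm _ _) _.
  exact: norm_le_cpath_norm.
Defined.

Lemma dual_tensor_evalE L s i x y : dual_tensor_eval L s i x y = L x * y s 0 i.
Proof. by []. Qed.

Lemma weakly_continuous_extension_exists (L : dual C) t : (1 <= n)%N ->
  exists Lbar : dual (jpath n t), weakly_continuous_extension L Lbar.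
Proof.
move=> n1; pose i := Ordinal n1.
pose one : C := const_path (const_mx 1).
have evE x : dual_tensor_eval L t i x one = L x.
  by rewrite dual_tensor_evalE const_pathE mxE mulr1.
have [ext wc] := bidual_extension_weakly_continuous (dual_tensor_eval L t i) t.
set Qbar := bidual_extension _ t in ext wc.
have lb : exists M, forall xi, `|Qbar xi (cpath_jpath t one)| <= M * `|xi|.
  have [K _ QK] := bidual_bound Qbar; exists (K * `|cpath_jpath t one|) => xi.
  by rewrite mulrAC; exact: QK.
exists (Dual (bidual_linearl Qbar (cpath_jpath t one)) lb); split=> [x|].
  exact: etrans (ext x one) (evE x).
move=> x_ xi bx xxi.
have -> : (fun k => L (x_ k)) = (fun k => dual_tensor_eval L t i (x_ k) one).
  by apply/funext => k; rewrite evE.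
apply: (wc x_ (fun=> one)) => //; first by exists `|one|.
move=> s; rewrite /jpath_fun scaler0 addr0.
exact: cvg_cst.
Qed.

End extension.

Theorem lemma2p11 (R : realType) (T : R) (T_gt0 : 0 < T)
    (n : nat) (n_ge1 : (1 <= n)%N)
    (Phi : time T -> cpath T n -> R)
    (Phi_nonanticipative : nonanticipative Phi)
    (Phi_C2 : twice_continuously_frechet Phi)
    (t : time T) (t_lt_T : val t < T) (phi : cpath T n) :
  (exists! Lbar : dual (jpath n t),
     weakly_continuous_extension (Dx Phi t phi) Lbar) /\
  (exists! Qbar : bidual (jpath n t),
     weakly_continuous_biextension (Dxx Phi t phi) Qbar).
Proof.
split.
  have [Lbar LbarP] :=
    weakly_continuous_extension_exists (Dx Phi t phi) t n_ge1.
  exists Lbar; split=> // L' L'P.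
  exact: weakly_continuous_extension_unique LbarP L'P.
exists (bidual_extension (Dxx Phi t phi) t).
have wc := bidual_extension_weakly_continuous (Dxx Phi t phi) t.
by split=> // Q' Q'P; exact: weakly_continuous_biextension_unique wc Q'P.
Qed.
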